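(* Let $H$ and $H'$ be two disconnected finite simple graphs on vertex sets $[p]$ and $[q]$, respectively, and let $G=H*H'$ be the join of $H$ and $H'$. With $S=S_G$, $$\operatorname{Hilb}_{S/J_G}(t)=\operatorname{Hilb}_{S_H/J_H}(t)+\operatorname{Hilb}_{S_{H'}/J_{H'}}(t)+\frac{(p+q-1)t+1}{(1-t)^{p+q+1}}-\frac{(p-1)t+1}{(1-t)^{p+1}}-\frac{(q-1)t+1}{(1-t)^{q+1}}.$$
   Context: $K$ is a field. For a finite simple graph $\Gamma$ (with totally ordered vertex set), $S_\Gamma=K[x_v,y_v : v\in V(\Gamma)]$ (standard graded) and the binomial edge ideal of $\Gamma$ is $J_\Gamma=(x_iy_j-x_jy_i : \{i,j\}\in E(\Gamma),\ i<j)\subset S_\Gamma$. The join $H*H'$ is the graph with vertex set the disjoint union $[p]\sqcup[q]$ and edge set $E(H)\cup E(H')\cup\{\{i,j\} : i\in[p],\ j\in[q]\}$. $\operatorname{Hilb}_M(t)=\sum_{k\ge0}\dim_K(M_k)t^k$ is the Hilbert series. *)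

(* Defs.v *)
From HB Require Import structures.
From mathcomp Require Import all_boot all_order all_algebra.
From mathcomp Require Import mpoly.
From Stdlib Require Import Classical ClassicalEpsilon.

Set Implicit Arguments.
Unset Strict Implicit.
Unset Printing Implicit Defensive.

Import GRing.Theory.
Local Open Scope ring_scope.

(* The vertices are 0, ..., n-1 in their natural order. *)
Record simple_graph (n : nat) := SimpleGraph {
  adj :> rel 'I_n;
  adj_sym : ssrbool.symmetric adj;
  adj_irrefl : irreflexive adj }.

Definition disconnected (n : nat) (G : simple_graph n) : bool :=
  [exists u, exists v, ~~ connect G u v].

(* The disjoint union of the vertex sets is 'I_(p + q): the vertex i of H
   becomes lshift q i, and the vertex j of H' becomes rshift p j. *)
Definition join_rel (p q : nat) (H : simple_graph p) (H' : simple_graph q) :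
    rel 'I_(p + q) :=
  fun u v => match split u, split v with
             | inl i, inl j => H i j
             | inr i, inr j => H' i j
             | _, _ => true
             end.

Lemma join_rel_sym p q (H : simple_graph p) (H' : simple_graph q) :
  ssrbool.symmetric (join_rel H H').
Proof.
by move=> u v; rewrite /join_rel; case: (split u); case: (split v) => // *;
  apply: adj_sym.
Qed.

Lemma join_rel_irrefl p q (H : simple_graph p) (H' : simple_graph q) :
  irreflexive (join_rel H H').
Proof.
by move=> u; rewrite /join_rel; case: (split u) => *; apply: adj_irrefl.
Qed.

Definition join_graph (p q : nat) (H : simple_graph p) (H' : simple_graph q) :
    simple_graph (p + q) :=
  SimpleGraph (@join_rel_sym p q H H') (@join_rel_irrefl p q H H').

(* S_G is {mpoly K[n + n]}: the first n variables are the x_i, the last n the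
   y_i. *)
Definition xvar (K : fieldType) (n : nat) (i : 'I_n) : {mpoly K[n + n]} :=
  'X_(lshift n i).

Definition yvar (K : fieldType) (n : nat) (i : 'I_n) : {mpoly K[n + n]} :=
  'X_(rshift n i).

Definition edge_binomial (K : fieldType) (n : nat) (i j : 'I_n) :
    {mpoly K[n + n]} :=
  xvar K i * yvar K j - xvar K j * yvar K i.

Definition binomial_edge_ideal (K : fieldType) (n : nat) (G : simple_graph n)
    (f : {mpoly K[n + n]}) : Prop :=
  exists c : 'I_n -> 'I_n -> {mpoly K[n + n]},
    f = \sum_(i < n) \sum_(j < n | (i < j)%N && G i j)
          c i j * edge_binomial K i j.
Arguments binomial_edge_ideal K {n} G f.

(* The residue classes of b_0, ..., b_(d-1) form a K-basis of the degree k
   part (S/J)_k of S/J, i.e. of the image of S_k in S/J. *)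
Definition is_basis_mod (K : fieldType) (m : nat) (J : {mpoly K[m]} -> Prop)
    (k d : nat) (b : 'I_d -> {mpoly K[m]}) : Prop :=
  (forall i, b i \is k.-homog) /\
  forall f : {mpoly K[m]}, f \is k.-homog ->
    exists! c : 'rV[K]_d, J (f - \sum_(i < d) c 0 i *: b i).

Definition has_dim_mod (K : fieldType) (m : nat) (J : {mpoly K[m]} -> Prop)
    (k d : nat) : Prop :=
  exists b : 'I_d -> {mpoly K[m]}, is_basis_mod J k b.

(* dim_K (S/J)_k for an ideal J: by has_dim_mod_exists and has_dim_mod_unique, the
   number chosen here exists and is unique. *)
Definition hilbert_function (K : fieldType) (m : nat)
    (J : {mpoly K[m]} -> Prop) (k : nat) : nat :=
  epsilon (inhabits 0%N) (has_dim_mod J k).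

(* A power series in Z[[t]] is given by its sequence of coefficients. *)
Definition hilbert_series (K : fieldType) (m : nat)
    (J : {mpoly K[m]} -> Prop) : nat -> int :=
  fun k => (hilbert_function J k)%:Z.

(* The power series expansion of P / Q, for Q`_0 a unit: from P = Q * c one
   gets c_k = (P_k - \sum_(i < k) Q_(k-i) c_i) / Q_0; see fps_fracE. *)
Definition fps_next (R : comUnitRingType) (P Q : {poly R}) (s : seq R) : R :=
  (P`_(size s) - \sum_(i < size s) Q`_(size s - i) * s`_i) / Q`_0.

Fixpoint fps_frac_seq (R : comUnitRingType) (P Q : {poly R}) (k : nat) :
    seq R :=
  if k is k'.+1 then
    let s := fps_frac_seq P Q k' in rcons s (fps_next P Q s)
  else [::].

Definition fps_frac (R : comUnitRingType) (P Q : {poly R}) (k : nat) : R :=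
  fps_next P Q (fps_frac_seq P Q k).

Lemma size_fps_frac_seq (R : comUnitRingType) (P Q : {poly R}) k :
  size (fps_frac_seq P Q k) = k.
Proof. by elim: k => //= k IH; rewrite size_rcons IH. Qed.

Lemma nth_fps_frac_seq (R : comUnitRingType) (P Q : {poly R}) k i :
  (i < k)%N -> (fps_frac_seq P Q k)`_i = fps_frac P Q i.
Proof.
elim: k => //= k IH; rewrite ltnS leq_eqVlt nth_rcons size_fps_frac_seq.
by case/orP=> [/eqP->|lt_ik]; rewrite ?ltnn ?eqxx // lt_ik IH.
Qed.

Lemma fps_fracE (R : comUnitRingType) (P Q : {poly R}) k :
  Q`_0 \is a GRing.unit ->
  \sum_(i < k.+1) Q`_(k - i) * fps_frac P Q i = P`_k.
Proof.
move=> uQ; rewrite big_ord_recr /= subnn {2}/fps_frac /fps_next.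
rewrite size_fps_frac_seq [Q`_0 * _]mulrC divrK //.
under [in X in _ - X]eq_bigr => i _ do rewrite nth_fps_frac_seq //.
by rewrite addrC subrK.
Qed.

Lemma binomial_edge_ideal0 (K : fieldType) n (G : simple_graph n) :
  binomial_edge_ideal K G 0.
Proof.
exists (fun _ _ => 0); rewrite big1 // => i _; rewrite big1 // => j _.
by rewrite mul0r.
Qed.

Lemma binomial_edge_idealD (K : fieldType) n (G : simple_graph n)
    (f g : {mpoly K[n + n]}) :
  binomial_edge_ideal K G f -> binomial_edge_ideal K G g ->
  binomial_edge_ideal K G (f + g).
Proof.
move=> [c ->] [d ->]; exists (fun i j => c i j + d i j).
rewrite -big_split; apply: eq_bigr => i _; rewrite -big_split.
by apply: eq_bigr => j _; rewrite mulrDl.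
Qed.

Lemma binomial_edge_idealM (K : fieldType) n (G : simple_graph n)
    (h f : {mpoly K[n + n]}) :
  binomial_edge_ideal K G f -> binomial_edge_ideal K G (h * f).
Proof.
move=> [c ->]; exists (fun i j => h * c i j).
rewrite mulr_sumr; apply: eq_bigr => i _; rewrite mulr_sumr.
by apply: eq_bigr => j _; rewrite mulrA.
Qed.

Definition is_ideal (R : comNzRingType) (J : R -> Prop) : Prop :=
  [/\ J 0, forall f g, J f -> J g -> J (f + g)
     & forall h f, J f -> J (h * f)].

Lemma binomial_edge_ideal_is_ideal (K : fieldType) n (G : simple_graph n) :
  is_ideal (binomial_edge_ideal K G).
Proof.
split; [exact: binomial_edge_ideal0 | exact: binomial_edge_idealD |].
exact: binomial_edge_idealM.
Qed.

Lemma is_idealZ (K : fieldType) m (J : {mpoly K[m]} -> Prop) a f :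
  is_ideal J -> J f -> J (a *: f).
Proof. by case=> _ _ JM Jf; rewrite -mul_mpolyC; apply: JM. Qed.

Lemma is_idealB (K : fieldType) m (J : {mpoly K[m]} -> Prop) f g :
  is_ideal J -> J f -> J g -> J (f - g).
Proof.
move=> iJ Jf Jg; case: (iJ) => _ JD _; apply: JD => //.
by rewrite -scaleN1r; apply: is_idealZ.
Qed.

Lemma is_ideal_sum (K : fieldType) m (J : {mpoly K[m]} -> Prop)
    (I : finType) (F : I -> {mpoly K[m]}) :
  is_ideal J -> (forall i, J (F i)) -> J (\sum_i F i).
Proof. by move=> [J0 JD _] JF; apply: big_ind. Qed.

Lemma has_dim_mod_le (K : fieldType) m (J : {mpoly K[m]} -> Prop) k d d' :
  is_ideal J -> has_dim_mod J k d -> has_dim_mod J k d' -> (d' <= d)%N.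
Proof.
move=> iJ [b [_ bB]] [b' [b'H b'B]].
have /fin_all_exists [M JM] i :
    exists c : 'rV[K]_d, J (b' i - \sum_j c 0 j *: b j).
  by have [c [Jc _]] := bB _ (b'H i); exists c.
pose A := \matrix_i M i.
suff : row_free A by rewrite -row_leq_rank => /leq_trans; apply; apply: rank_leq_col.
rewrite -kermx_eq0; apply/eqP/row_matrixP => r; rewrite row0.
set u := row r _.
have uA : u *m A = 0 by rewrite /u -row_mul mulmx_ker row0.
have [c [_ cU]] := b'B 0 (rpred0 _).
have J0 : J 0 by case: iJ.
have <- : c = 0.
  by apply: cU; rewrite big1 ?subrr // => i _; rewrite mxE scale0r.
symmetry; apply: cU.
suff <- : - 1 *: \sum_i u 0 i *: (b' i - \sum_j M i 0 j *: b j)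
         = 0 - \sum_i u 0 i *: b' i.
  by apply: is_idealZ => //; apply: is_ideal_sum => // i; apply: is_idealZ.
rewrite scaleN1r sub0r; congr (- _).
under eq_bigr do rewrite scalerBr; rewrite sumrB.
suff -> : \sum_i u 0 i *: (\sum_j M i 0 j *: b j) = 0 by rewrite subr0.
under eq_bigr do rewrite scaler_sumr.
rewrite exchange_big /= big1 // => j _.
under eq_bigr do rewrite scalerA; rewrite -scaler_suml.
have := congr1 (fun B : 'rV_d => B 0 j) uA; rewrite !mxE => E.
by under eq_bigr => i do [rewrite (_ : M i 0 j = A i j); last by rewrite mxE];
   rewrite E scale0r.
Qed.

Lemma has_dim_mod_unique (K : fieldType) m (J : {mpoly K[m]} -> Prop) k d d' :
  is_ideal J -> has_dim_mod J k d -> has_dim_mod J k d' -> d = d'.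
Proof. by move=> iJ D D'; apply/eqP; rewrite eqn_leq !(@has_dim_mod_le _ _ J k). Qed.

Lemma indep_mod_exists (K : fieldType) m (J : {mpoly K[m]} -> Prop) k
    (s : seq {mpoly K[m]}) :
  is_ideal J -> (forall f, f \in s -> f \is k.-homog) ->
  exists d (b : 'I_d -> {mpoly K[m]}),
    [/\ forall i, b i \is k.-homog,
        forall c : 'rV[K]_d, J (\sum_i c 0 i *: b i) -> c = 0
      & forall f, f \in s ->
          exists c : 'rV[K]_d, J (f - \sum_i c 0 i *: b i)].
Proof.
move=> iJ; elim: s => [|v s IH] sH.
  exists 0%N, (fun _ => 0); split=> [[]//|c _|//].
  by apply/rowP; case.
have [|d [b [bH bI bS]]] := IH; first by move=> f sf; apply: sH; rewrite inE sf orbT.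
have [Jv|nJv] := classic (exists c : 'rV[K]_d, J (v - \sum_i c 0 i *: b i)).
  exists d, b; split=> // f; rewrite inE => /orP[/eqP->//|]; exact: bS.
pose b' (i : 'I_(1 + d)) := match split i with inl _ => v | inr j => b j end.
have b'0 : b' (lshift d ord0) = v by rewrite /b' (unsplitK (inl _ _)).
have b'S j : b' (rshift 1 j) = b j by rewrite /b' (unsplitK (inr _ _)).
have b'E (c : 'rV[K]_(1 + d)) : \sum_i c 0 i *: b' i
    = c 0 (lshift d ord0) *: v + \sum_i rsubmx c 0 i *: b i.
  rewrite big_split_ord big_ord1 b'0; congr (_ + _).
  by apply: eq_bigr => i _; rewrite b'S mxE.
exists (1 + d)%N, b'; split.
- move=> i; rewrite /b'; case: (split i) => // _.
  by apply: sH; rewrite mem_head.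
- move=> c; rewrite b'E => Jc.
  have c0 : c 0 (lshift d ord0) = 0.
    apply/eqP/negPn/negP => nz; case: nJv.
    exists (- (c 0 (lshift d ord0))^-1 *: rsubmx c).
    have -> : v - \sum_i (- (c 0 (lshift d ord0))^-1 *: rsubmx c) 0 i *: b i
       = (c 0 (lshift d ord0))^-1 *:
         (c 0 (lshift d ord0) *: v + \sum_i rsubmx c 0 i *: b i).
      rewrite scalerDr scalerA mulVf // scale1r; congr (_ + _).
      rewrite -sumrN scaler_sumr; apply: eq_bigr => i _.
      by rewrite [in LHS]mxE scalerA mulNr scaleNr opprK.
    exact: is_idealZ.
  move: Jc; rewrite c0 scale0r add0r => /bI cr.
  apply/rowP => i; rewrite mxE.
  case: (split_ordP i) => j ->; first by rewrite (ord1 j).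
  by have := congr1 (fun B : 'rV_d => B 0 j) cr; rewrite !mxE.
- move=> f; rewrite inE => /orP[/eqP->|/bS [c Jc]].
    exists (row_mx 1%:M 0); rewrite b'E row_mxEl mxE eqxx scale1r row_mxKr.
    rewrite big1 ?addr0 ?subrr; first by case: iJ.
    by move=> i _; rewrite mxE scale0r.
  by exists (row_mx 0 c); rewrite b'E row_mxEl mxE scale0r add0r row_mxKr.
Qed.

Lemma has_dim_mod_exists (K : fieldType) m (J : {mpoly K[m]} -> Prop) k :
  is_ideal J -> exists d, has_dim_mod J k d.
Proof.
move=> iJ.
pose s : seq {mpoly K[m]} :=
  [seq 'X_[val a] | a <- enum [pred a : 'X_{1..m < k.+1} | mdeg a == k]].
have sH f : f \in s -> f \is k.-homog.
  by case/mapP => a; rewrite mem_enum inE => ak ->; rewrite dhomogX.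
have [d [b [bH bI bS]]] := indep_mod_exists iJ sH.
exists d, b; split=> // f fH.
have fE : f = \sum_(a : 'X_{1..m < k.+1}) f@_a *: 'X_[a].
  apply: mpolywE; rewrite msizeE; apply/bigmax_leqP_seq => a fa _.
  by rewrite (dhomogP _ _ _ fH).
have /fin_all_exists [C JC] (a : 'X_{1..m < k.+1}) :
    exists c : 'rV[K]_d, J (f@_a *: 'X_[a] - \sum_i c 0 i *: b i).
  have [ak|nak] := eqVneq (mdeg a) k; last first.
    exists 0; rewrite (dhomog_nemf_coeff fH) // scale0r big1 ?subrr.
      by case: iJ.
    by move=> i _; rewrite mxE scale0r.
  have [|c Jc] := bS 'X_[a].
    by apply/mapP; exists a; rewrite ?mem_enum ?inE ?ak.
  exists (f@_a *: c).
  suff -> : f@_a *: 'X_[a] - \sum_i (f@_a *: c) 0 i *: b i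
       = f@_a *: ('X_[a] - \sum_i c 0 i *: b i) by apply: is_idealZ.
  rewrite scalerBr scaler_sumr; congr (_ - _).
  by apply: eq_bigr => i _; rewrite mxE scalerA.
have Jf : J (f - \sum_i (\sum_a C a) 0 i *: b i).
  suff -> : f - \sum_i (\sum_a C a) 0 i *: b i
      = \sum_(a : 'X_{1..m < k.+1})
          (f@_a *: 'X_[a] - \sum_i C a 0 i *: b i) by apply: is_ideal_sum.
  rewrite sumrB -fE exchange_big /=; congr (_ - _).
  by apply: eq_bigr => i _; rewrite summxE scaler_suml.
exists (\sum_a C a); split=> // c' Jc'.
apply/eqP; rewrite eq_sym -subr_eq0; apply/eqP/bI.
suff -> : \sum_i (c' - \sum_a C a) 0 i *: b i
   = (f - \sum_i (\sum_a C a) 0 i *: b i) - (f - \sum_i c' 0 i *: b i).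
  exact: is_idealB.
rewrite opprB [RHS]addrC addrA subrK -sumrB.
by apply: eq_bigr => i _; rewrite !mxE scalerBl.
Qed.

Lemma hilbert_functionP (K : fieldType) m (J : {mpoly K[m]} -> Prop) k :
  is_ideal J -> has_dim_mod J k (hilbert_function J k).
Proof. by move=> iJ; apply: epsilon_spec; apply: has_dim_mod_exists. Qed.

(* Main.v *)
(* Every polynomial of J_{K_(p+q)} is, modulo J_G, the sum of its restrictions
   to the two sides (all variables of the other side set to 0): for i, j on one
   side and k on the other, the Pluecker relation x_k e_ij = x_i e_kj - x_j e_ki
   shows that x_k (and likewise y_k) annihilates e_ij modulo J_G.  Restricting
   to a side maps J_G into J_H (resp. J_H'), so in every degree
   J_{K_(p+q)} / J_G is the direct sum of J_{K_p} / J_H and J_{K_q} / J_H'.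
   The Hilbert series of S / J_{K_n} is that of a Segre product: a monomial is
   determined modulo J_{K_n} by its multidegree and its total degree in x. *)

From HB Require Import structures.
Require Import Defs.
From mathcomp Require Import all_boot all_order all_algebra.
From mathcomp Require Import mpoly.
From mathcomp Require Import zify ring.

Set Implicit Arguments.
Unset Strict Implicit.
Unset Printing Implicit Defensive.

Import GRing.Theory.
Local Open Scope ring_scope.

(** * Dimensions of quotients of subspaces *)

Definition is_subspace (K : fieldType) (V : lmodType K) (B : V -> Prop) :=
  B 0 /\ forall a u v, B u -> B v -> B (a *: u + v).

(* dim A / (A n B); has_dim_mod J k is the case where A is the space of forms
   of degree k and B = J. *)
Definition quot_dim (K : fieldType) (V : lmodType K) (A B : V -> Prop)
    (d : nat) : Prop :=
  exists b : 'I_d -> V, (forall i, A (b i)) /\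
    forall f, A f -> exists! c : 'rV[K]_d, B (f - \sum_(i < d) c 0 i *: b i).

Section QuotDim.
Variables (K : fieldType) (V : lmodType K).
Implicit Types (A B C : V -> Prop).

Lemma subspaceZ B a u : is_subspace B -> B u -> B (a *: u).
Proof. by case=> B0 BL Bu; rewrite -[_ *: _]addr0; apply: BL. Qed.

Lemma subspaceD B u v : is_subspace B -> B u -> B v -> B (u + v).
Proof. by case=> B0 BL Bu Bv; rewrite -[u]scale1r; apply: BL. Qed.

Lemma subspaceB B u v : is_subspace B -> B u -> B v -> B (u - v).
Proof.
by case=> B0 BL Bu Bv; rewrite addrC -scaleN1r; apply: BL.
Qed.

Lemma subspace_sum B (I : Type) (r : seq I) (P : pred I) (F : I -> V) :
  is_subspace B -> (forall i, P i -> B (F i)) -> B (\sum_(i <- r | P i) F i).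
Proof.
move=> sB BF; apply: big_ind => //; first by case: sB.
by move=> u v; apply: subspaceD.
Qed.

(** Existence and uniqueness of coordinates split into spanning and independence. Allowing any
    finite index type [T] lets later bases be indexed by sums and products. *)
Lemma quot_dimI A B (T : finType) (b : T -> V) :
  is_subspace B -> (forall t, A (b t)) ->
  (forall c : T -> K, B (\sum_t c t *: b t) -> forall t, c t = 0) ->
  (forall f, A f -> exists c : T -> K, B (f - \sum_t c t *: b t)) ->
  quot_dim A B #|T|.
Proof.
move=> sB Ab indep span; exists (b \o enum_val); split=> [i|f Af].
  exact: Ab.
have E (c : 'rV[K]_#|T|) : \sum_i c 0 i *: (b \o enum_val) i
    = \sum_t c 0 (enum_rank t) *: b t.
  rewrite (reindex (@enum_rank T)) /=; last exact/onW_bij/enum_rank_bij.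
  by apply: eq_bigr => t _; rewrite enum_rankK.
have [c Bc] := span f Af.
exists (\row_i c (enum_val i)); split.
  rewrite E; congr (B (f - _)): Bc.
  by apply: eq_bigr => t _; rewrite mxE enum_rankK.
move=> c'; rewrite E => Bc'; apply/rowP => i; rewrite mxE.
apply/eqP; rewrite -subr_eq0; apply/eqP.
rewrite -[i in c' 0 i]enum_valK.
apply: (indep (fun t => c t - c' 0 (enum_rank t))).
rewrite (_ : \sum_t _ = (f - \sum_t c' 0 (enum_rank t) *: b t)
                        - (f - \sum_t c t *: b t)); first exact: subspaceB.
rewrite opprB [RHS]addrC addrA subrK -sumrB.
by apply: eq_bigr => t _; rewrite scalerBl.
Qed.

(** Independence is the uniqueness of the coordinates of the zero vector, which is why [A 0] is
    assumed. *)
Lemma quot_dimE A B d :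
  A 0 -> is_subspace B -> quot_dim A B d -> exists b : 'I_d -> V,
  [/\ forall i, A (b i),
      forall c : 'I_d -> K, B (\sum_i c i *: b i) -> forall i, c i = 0
    & forall f, A f -> exists c : 'I_d -> K, B (f - \sum_i c i *: b i)].
Proof.
move=> A0 sB [b [Ab bB]]; exists b; split=> // [c Bc i|f Af]; last first.
  by have [c [Bc _]] := bB f Af; exists (c 0).
have [c0 [_ c0U]] := bB 0 A0.
have Z : c0 = 0.
  apply: c0U; rewrite big1 ?subrr; first by case: sB.
  by move=> j _; rewrite mxE scale0r.
have /rowP/(_ i) : c0 = \row_j c j.
  apply: c0U; rewrite sub0r -scaleN1r; apply: subspaceZ => //.
  by congr B: Bc; apply: eq_bigr => j _; rewrite mxE.
by rewrite Z !mxE.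
Qed.

(** Additivity of dimension in the exact sequence from [(A n B) / (A n C)] through [A / (A n C)] to
    [A / (A n B)]: the union of bases of the two outer terms is a basis of the middle one. *)
Lemma quot_dim_cat A B C d e :
  is_subspace A -> is_subspace B -> is_subspace C -> (forall v, C v -> B v) ->
  quot_dim A B d -> quot_dim (fun v => A v /\ B v) C e ->
  quot_dim A C (d + e).
Proof.
move=> sA sB sC CB.
have AB0 : A 0 /\ B 0 by split; [case: sA | case: sB].
case/(quot_dimE (proj1 sA) sB) => b [Ab bI bS].
case/(@quot_dimE (fun v => A v /\ B v) C e AB0 sC) => b' [ABb' b'I b'S].
rewrite -[d]card_ord -[e]card_ord -card_sum.
pose w (t : 'I_d + 'I_e) := match t with inl i => b i | inr j => b' j end.
have wE (c : 'I_d + 'I_e -> K) : \sum_t c t *: w t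
   = \sum_i c (inl i) *: b i + \sum_j c (inr j) *: b' j by rewrite big_sumType.
have Bb' (c : 'I_e -> K) : B (\sum_j c j *: b' j).
  by apply: subspace_sum => // j _; apply: subspaceZ => //; case: (ABb' j).
apply: (@quot_dimI A C _ w) => // [[i|j]|c|f Af]; first exact: Ab.
- by case: (ABb' j).
- rewrite wE => Cc.
  (* The second block of the basis lies in [B], so modulo [B] only the first block is seen; once its
     coefficients vanish, independence modulo [C] handles the rest. *)
  have cl : forall i, c (inl i) = 0.
    apply: bI; rewrite -[\sum_i _](addrK (\sum_j c (inr j) *: b' j)).
    by apply: subspaceB => //; apply: CB.
  have cr : forall j, c (inr j) = 0.
    apply: b'I; congr C: Cc; rewrite big1 ?add0r // => i _.
    by rewrite cl scale0r.
  by case.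
- have [c Bc] := bS f Af.
  have [|c' Cc'] := b'S (f - \sum_i c i *: b i).
    split=> //; apply: subspaceB => //; apply: subspace_sum => // i _.
    exact: subspaceZ.
  exists (fun t => match t with inl i => c i | inr j => c' j end).
  by rewrite wE opprD addrA.
Qed.

(** The quotient in question is the kernel of the surjection from [A / (A n C)] to [A / (A n B)], so
    it is finite-dimensional. Its basis is read off from the kernel of the matrix of that map. *)
Lemma quot_dim_ker A B C d e :
  is_subspace A -> is_subspace B -> is_subspace C -> (forall v, C v -> B v) ->
  quot_dim A C d -> quot_dim A B e ->
  exists r, quot_dim (fun v => A v /\ B v) C r.
Proof.
move=> sA sB sC CB.
case/(quot_dimE (proj1 sA) sC) => b [Ab bI bS].
case/(quot_dimE (proj1 sA) sB) => b' [Ab' b'I b'S].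
have /fin_all_exists [m Bm] i := b'S _ (Ab i).
(* [M] turns coordinates modulo [C] into coordinates modulo [B]; by [kerM] its left kernel describes
   the combinations that lie in [B]. *)
pose M := \matrix_(i, j) m i j.
have BM (u : 'rV_d) : B (\sum_i u 0 i *: b i - \sum_j (u *m M) 0 j *: b' j).
  suff -> : \sum_i u 0 i *: b i - \sum_j (u *m M) 0 j *: b' j
      = \sum_i u 0 i *: (b i - \sum_j m i j *: b' j).
    by apply: subspace_sum => // i _; apply: subspaceZ.
  under [RHS]eq_bigr do rewrite scalerBr scaler_sumr.
  rewrite sumrB exchange_big; congr (_ - _); apply: eq_bigr => j _.
  rewrite mxE scaler_suml; apply: eq_bigr => i _.
  by rewrite mxE scalerA.
have kerM (u : 'rV_d) : B (\sum_i u 0 i *: b i) <-> u *m M = 0.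
  split=> [Bu|uM].
    apply/rowP => j; rewrite [RHS]mxE.
    apply: (b'I (fun j => (u *m M) 0 j)).
    by have := subspaceB sB Bu (BM u); rewrite opprB addrC subrK.
  have := BM u; rewrite uM [X in _ - X]big1 ?subr0 // => j _.
  by rewrite mxE scale0r.
pose N := row_base (kermx M).
exists (\rank (kermx M)); rewrite -[\rank _]card_ord.
pose w s := \sum_i N s i *: b i.
have wE (c : 'I_(\rank (kermx M)) -> K) :
    \sum_s c s *: w s = \sum_i (\row_s c s *m N) 0 i *: b i.
  under eq_bigr do rewrite scaler_sumr.
  rewrite exchange_big /=; apply: eq_bigr => i _.
  rewrite [in RHS]mxE scaler_suml; apply: eq_bigr => s _.
  by rewrite [(\row_s c s) 0 s]mxE scalerA.
apply: (@quot_dimI _ C _ w) => // [s|c|f [Af Bf]].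
- split.
    by apply: subspace_sum => // i _; apply: subspaceZ.
  have /kerM : row s N *m M = 0.
    by apply/sub_kermxP; rewrite -(eq_row_base (kermx M)) row_sub.
  by congr B; apply: eq_bigr => i _; rewrite mxE.
- rewrite wE => Cc s.
  suff /rowP/(_ s) : \row_s c s = 0 by rewrite !mxE.
  apply/eqP; rewrite -(mulmx_free_eq0 _ (row_base_free (kermx M))).
  apply/eqP/rowP => i; rewrite [RHS]mxE.
  exact: (bI (fun i => (\row_s c s *m N) 0 i)).
- have [c Cc] := bS f Af.
  have /kerM/sub_kermxP : B (\sum_i (\row_i c i) 0 i *: b i).
    have := subspaceB sB Bf (CB _ Cc); rewrite opprB addrC subrK.
    by congr B; apply: eq_bigr => i _; rewrite mxE.
  rewrite -(eq_row_base (kermx M)) => /submxP [u uE].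
  exists (u 0); rewrite wE; congr (C (f - _)): Cc.
  apply: eq_bigr => i _; congr (_ *: _).
  have -> : \row_s u 0 s = u by apply/rowP => s; rewrite mxE.
  by rewrite -uE mxE.
Qed.
End QuotDim.

(** * Substitutions induced by partial maps of vertices *)

Lemma mpoly_ring_ind (R : ringType) (n : nat) (P : {mpoly R[n]} -> Prop) :
  (forall c, P c%:MP) -> (forall i, P 'X_i) ->
  (forall f g, P f -> P g -> P (f + g)) ->
  (forall f g, P f -> P g -> P (f * g)) -> forall f, P f.
Proof.
move=> PC PX PD PM f; rewrite (mpolyE f); apply: big_ind => // [|m _].
  by rewrite -mpolyC0.
rewrite -mul_mpolyC; apply: (PM) => //; rewrite mpolyXE_id.
have P1 : P 1 by rewrite -mpolyC1.
apply: big_ind => [||i _]; [exact: P1 | exact: (PM) |].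
by elim: (m i) => [|k IHk]; rewrite ?expr0 // exprS; apply: (PM).
Qed.

(** * Generators of binomial edge ideals, and the complete graph *)

Section EdgeIdeal.
Variables (K : fieldType) (n : nat).
Implicit Types (G : simple_graph n).

Lemma is_ideal_subspace m (J : {mpoly K[m]} -> Prop) :
  is_ideal J -> is_subspace J.
Proof.
move=> iJ; case: (iJ) => J0 JD JM; split=> // a u v Ju Jv.
by apply: JD => //; apply: is_idealZ.
Qed.

Lemma edge_binomialC (i j : 'I_n) : edge_binomial K i j = - edge_binomial K j i.
Proof. by rewrite /edge_binomial opprB. Qed.

Lemma edge_binomialxx (i : 'I_n) : edge_binomial K i i = 0.
Proof. by rewrite /edge_binomial subrr. Qed.

Lemma edge_ideal_binomial G i j :
  G i j -> binomial_edge_ideal K G (edge_binomial K i j).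
Proof.
(* The generators are indexed by increasing pairs; a decreasing pair gives the same binomial up to
   sign. *)
have lt_case (a b : 'I_n) : (a < b)%N -> G a b ->
    binomial_edge_ideal K G (edge_binomial K a b).
  move=> ab Gab; exists (fun u v => ((u == a) && (v == b))%:R).
  rewrite (bigD1 a) //= (bigD1 b) ?ab //= !eqxx mul1r.
  rewrite !big1 ?addr0 // => [u /negbTE ua|v /andP [_ /negbTE ->]].
    by rewrite big1 // => v _; rewrite ua mul0r.
  by rewrite mul0r.
case: (ltngtP i j) => [lt_ij|lt_ji|/val_inj ->] Gij; first exact: lt_case.
  rewrite edge_binomialC -mulN1r; apply: binomial_edge_idealM.
  by apply: lt_case; rewrite // adj_sym.
by rewrite adj_irrefl in Gij.
Qed.

Lemma edge_ideal_ind G (P : {mpoly K[n + n]} -> Prop) :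
  P 0 -> (forall f g, P f -> P g -> P (f + g)) ->
  (forall h i j, G i j -> P (h * edge_binomial K i j)) ->
  forall f, binomial_edge_ideal K G f -> P f.
Proof.
move=> P0 PD PG f [c ->]; apply: big_ind => // i _.
by apply: big_ind => // j /andP [_ Gij]; apply: PG.
Qed.

End EdgeIdeal.

Definition complete_rel (n : nat) : rel 'I_n := fun i j => i != j.

Lemma complete_rel_sym n : ssrbool.symmetric (@complete_rel n).
Proof. by move=> i j; rewrite /complete_rel eq_sym. Qed.

Lemma complete_rel_irrefl n : irreflexive (@complete_rel n).
Proof. by move=> i; rewrite /complete_rel eqxx. Qed.

Definition complete_graph n : simple_graph n :=
  SimpleGraph (@complete_rel_sym n) (@complete_rel_irrefl n).

Lemma edge_ideal_complete (K : fieldType) n (i j : 'I_n) :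
  binomial_edge_ideal K (complete_graph n) (edge_binomial K i j).
Proof.
have [->|ij] := eqVneq i j; last exact: edge_ideal_binomial.
by rewrite edge_binomialxx; apply: binomial_edge_ideal0.
Qed.

Lemma edge_ideal_sub_complete (K : fieldType) n (G : simple_graph n) f :
  binomial_edge_ideal K G f -> binomial_edge_ideal K (complete_graph n) f.
Proof.
apply: edge_ideal_ind => [|f1 f2|h i j _].
- exact: binomial_edge_ideal0.
- exact: binomial_edge_idealD.
- exact/binomial_edge_idealM/edge_ideal_complete.
Qed.

(** A vertex sent to [None] has both of its variables set to 0, so inclusions of a side,
    restrictions to a side and their composites are all of this form. *)
Definition vsubst (K : fieldType) (m n : nat) (s : 'I_m -> option 'I_n) :
    {mpoly K[m + m]} -> {mpoly K[n + n]} :=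
  mmap (@mpolyC _ K) (fun v => match split v with
                               | inl i => oapp (@xvar K n) 0 (s i)
                               | inr i => oapp (@yvar K n) 0 (s i)
                               end).

HB.instance Definition _ (K : fieldType) m n (s : 'I_m -> option 'I_n) :=
  GRing.RMorphism.copy (vsubst (K := K) s)
    (mmap (@mpolyC _ K) (fun v => match split v with
                                  | inl i => oapp (@xvar K n) 0 (s i)
                                  | inr i => oapp (@yvar K n) 0 (s i)
                                  end)).

Section Vsubst.
Variable K : fieldType.

Lemma vsubstC m n (s : 'I_m -> option 'I_n) (c : K) : vsubst s c%:MP = c%:MP.
Proof. exact: mmapC. Qed.

Lemma vsubstZ m n (s : 'I_m -> option 'I_n) (c : K) f :
  vsubst s (c *: f) = c *: vsubst s f.
Proof. by rewrite -!mul_mpolyC rmorphM /= vsubstC. Qed.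

Lemma vsubst_xvar m n (s : 'I_m -> option 'I_n) i :
  vsubst s (xvar K i) = oapp (@xvar K n) 0 (s i).
Proof. by rewrite /vsubst mmapX mmap1U (unsplitK (inl i)). Qed.

Lemma vsubst_yvar m n (s : 'I_m -> option 'I_n) i :
  vsubst s (yvar K i) = oapp (@yvar K n) 0 (s i).
Proof. by rewrite /vsubst mmapX mmap1U (unsplitK (inr i)). Qed.

Lemma vsubst_edge m n (s : 'I_m -> option 'I_n) i j :
  vsubst s (edge_binomial K i j) =
  if (s i, s j) is (Some a, Some b) then edge_binomial K a b else 0.
Proof.
rewrite rmorphB !rmorphM /= !vsubst_xvar !vsubst_yvar.
by case: (s i) => [a|]; case: (s j) => [b|] //=; rewrite !(mul0r, mulr0) subrr.
Qed.

Lemma mpoly_xy_ind n (P : {mpoly K[n + n]} -> Prop) :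
  (forall c, P c%:MP) -> (forall i, P (xvar K i)) -> (forall i, P (yvar K i)) ->
  (forall f g, P f -> P g -> P (f + g)) ->
  (forall f g, P f -> P g -> P (f * g)) -> forall f, P f.
Proof.
move=> PC Px Py PD PM; apply: mpoly_ring_ind => // v.
by case: (split_ordP v) => i ->; [exact: Px | exact: Py]. 
Qed.

Lemma vsubst_comp l m n (s : 'I_l -> option 'I_m) (t : 'I_m -> option 'I_n) f :
  vsubst t (vsubst s f) = vsubst (fun i => obind t (s i)) f :> {mpoly K[n + n]}.
Proof.
elim/mpoly_xy_ind: f => [c|i|i|f g IHf IHg|f g IHf IHg].
- by rewrite !vsubstC.
- by rewrite !vsubst_xvar; case: (s i) => [j|] /=;
    rewrite ?vsubst_xvar ?rmorph0.
- by rewrite !vsubst_yvar; case: (s i) => [j|] /=;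
    rewrite ?vsubst_yvar ?rmorph0.
- by rewrite !rmorphD /= IHf IHg.
- by rewrite !rmorphM /= IHf IHg.
Qed.

Lemma eq_vsubst m n (s t : 'I_m -> option 'I_n) :
  s =1 t -> vsubst s =1 vsubst t :> ({mpoly K[m + m]} -> _).
Proof.
move=> st f; elim/mpoly_xy_ind: f => [c|i|i|f g IHf IHg|f g IHf IHg].
- by rewrite !vsubstC.
- by rewrite !vsubst_xvar st.
- by rewrite !vsubst_yvar st.
- by rewrite !rmorphD /= IHf IHg.
- by rewrite !rmorphM /= IHf IHg.
Qed.

Lemma vsubst_id n f : vsubst Some f = f :> {mpoly K[n + n]}.
Proof.
elim/mpoly_xy_ind: f => [c|i|i|f g IHf IHg|f g IHf IHg].
- by rewrite vsubstC.
- by rewrite vsubst_xvar.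
- by rewrite vsubst_yvar.
- by rewrite rmorphD /= IHf IHg.
- by rewrite rmorphM /= IHf IHg.
Qed.

Lemma mmap1_homog l n (h : 'I_l -> {mpoly K[n]}) (m : 'X_{1..l}) :
  (forall i, h i \is 1.-homog) -> mmap1 h m \is (mdeg m).-homog.
Proof.
move=> hh; rewrite mdegE /mmap1.
elim/big_ind2: _ => [|d f e g df eg|i _]; first exact: dhomog1.
  exact: dhomogM.
by have := dhomogMn (m i) (hh i); rewrite mul1n.
Qed.

Lemma vsubst_homog m n (s : 'I_m -> option 'I_n) k (f : {mpoly K[m + m]}) :
  f \is k.-homog -> vsubst s f \is k.-homog.
Proof.
move=> /dhomogP fk; rewrite /vsubst /mmap big_seq.
apply: rpred_sum => a /fk <-; rewrite mul_mpolyC; apply/rpredZ/mmap1_homog => v.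
by case: (split v) => i; case: (s i) => [j|] /=;
  rewrite ?rpred0 // dhomogX /= mdeg1.
Qed.

(** A generator maps to 0 or to the binomial of the image pair. The case [a = b] is harmless because
    that binomial is then 0; hence every partial map respects the ideals of complete graphs. *)
Lemma vsubst_ideal m n (s : 'I_m -> option 'I_n) (G : simple_graph m)
    (G' : simple_graph n) f :
  (forall i j a b, G i j -> s i = Some a -> s j = Some b -> a = b \/ G' a b) ->
  binomial_edge_ideal K G f -> binomial_edge_ideal K G' (vsubst s f).
Proof.
move=> GG'; move: f; apply: edge_ideal_ind => [|f g|h i j Gij].
- by rewrite rmorph0; apply: binomial_edge_ideal0.
- by rewrite rmorphD; apply: binomial_edge_idealD.
rewrite rmorphM /= vsubst_edge; apply: binomial_edge_idealM.
case si: (s i) => [a|]; last exact: binomial_edge_ideal0.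
case sj: (s j) => [b|]; last exact: binomial_edge_ideal0.
have [<-|G'ab] := GG' _ _ _ _ Gij si sj; last exact: edge_ideal_binomial.
by rewrite edge_binomialxx; apply: binomial_edge_ideal0.
Qed.

Lemma vsubst_kill_edges m n (s : 'I_m -> option 'I_n) (G : simple_graph m) f :
  (forall i j, G i j -> s i = None \/ s j = None \/ s i = s j) ->
  binomial_edge_ideal K G f -> vsubst s f = 0.
Proof.
move=> sN; move: f; apply: edge_ideal_ind => [|f g f0 g0|h i j Gij].
- by rewrite rmorph0.
- by rewrite rmorphD /= f0 g0 addr0.
rewrite rmorphM /= vsubst_edge.
have := sN _ _ Gij.
case: (s i) => [a|]; last by rewrite mulr0.
case: (s j) => [b|]; last by rewrite mulr0.
by case=> [//|[//|[->]]]; rewrite edge_binomialxx mulr0.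
Qed.

(* The Pluecker relation x_k e_ij = x_i e_kj - x_j e_ki, together with its
   analogue for y, makes every vertex k adjacent to both i and j annihilate
   e_ij modulo the ideal. *)
Lemma edge_ideal_common_neighbour n (G : simple_graph n) i j k :
  G k i -> G k j ->
  binomial_edge_ideal K G (xvar K k * edge_binomial K i j) /\
  binomial_edge_ideal K G (yvar K k * edge_binomial K i j).
Proof.
move=> Gki Gkj.
have E (z : 'I_n -> {mpoly K[n + n]}) :
    z k * edge_binomial K i j
      = z i * edge_binomial K k j + (- z j) * edge_binomial K k i ->
    binomial_edge_ideal K G (z k * edge_binomial K i j).
  move=> ->; apply: binomial_edge_idealD; apply: binomial_edge_idealM;
    exact: edge_ideal_binomial.
by split; apply: E; rewrite /edge_binomial; ring.
Qed.
End Vsubst.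

(** * The join *)

Section Join.
Variable K : fieldType.

Lemma vsubst_sum m n (s : 'I_m -> option 'I_n) (T : finType) (c : T -> K) b :
  vsubst s (\sum_t c t *: b t) = \sum_t c t *: vsubst s (b t).
Proof. by rewrite rmorph_sum; apply: eq_bigr => t _; apply: vsubstZ. Qed.

(** The annihilation by common neighbours, passed from variables to all polynomials: vertices that
    [s] kills are adjacent to both [i] and [j], so modulo the ideal the coefficient [h] of the edge
    binomial may be replaced by [vsubst s h]. *)
Lemma edge_ideal_retract n (G : simple_graph n) (s : 'I_n -> option 'I_n)
    i j h :
  (forall v, s v = Some v \/ [/\ s v = None, G v i & G v j]) ->
  binomial_edge_ideal K G ((h - vsubst s h) * edge_binomial K i j).
Proof.
move=> sP.
elim/mpoly_xy_ind: h => [c|v|v|f g IHf IHg|f g IHf IHg].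
- by rewrite vsubstC subrr mul0r; apply: binomial_edge_ideal0.
- rewrite vsubst_xvar; have [->|[-> Gvi Gvj]] := sP v.
    by rewrite subrr mul0r; apply: binomial_edge_ideal0.
  by rewrite subr0; have [] := edge_ideal_common_neighbour K Gvi Gvj.
- rewrite vsubst_yvar; have [->|[-> Gvi Gvj]] := sP v.
    by rewrite subrr mul0r; apply: binomial_edge_ideal0.
  by rewrite subr0; have [] := edge_ideal_common_neighbour K Gvi Gvj.
- rewrite rmorphD /= opprD addrACA mulrDl.
  exact: binomial_edge_idealD.
- rewrite rmorphM /=.
  (* Telescoping of a difference of products, which reduces the product to the two induction
     hypotheses. *)
  rewrite (_ : (f * g - vsubst s f * vsubst s g) * edge_binomial K i j =
    g * ((f - vsubst s f) * edge_binomial K i j)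
    + vsubst s f * ((g - vsubst s g) * edge_binomial K i j)); last by ring.
  by apply: binomial_edge_idealD; apply: binomial_edge_idealM.
Qed.

Variables p q : nat.

Definition left_part (v : 'I_(p + q)) : option 'I_p :=
  if split v is inl i then Some i else None.

Definition right_part (v : 'I_(p + q)) : option 'I_q :=
  if split v is inr j then Some j else None.

Definition left_vertex (i : 'I_p) : option 'I_(p + q) := Some (lshift q i).

Definition right_vertex (j : 'I_q) : option 'I_(p + q) := Some (rshift p j).

Lemma left_part_lshift i : left_part (lshift q i) = Some i.
Proof. by rewrite /left_part (unsplitK (inl i)). Qed.

Lemma left_part_rshift j : left_part (rshift p j) = None.
Proof. by rewrite /left_part (unsplitK (inr j)). Qed.

Lemma right_part_lshift i : right_part (lshift q i) = None.
Proof. by rewrite /right_part (unsplitK (inl i)). Qed.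

Lemma right_part_rshift j : right_part (rshift p j) = Some j.
Proof. by rewrite /right_part (unsplitK (inr j)). Qed.

Definition part_shiftE :=
  (left_part_lshift, left_part_rshift, right_part_lshift, right_part_rshift).

Variables (H : simple_graph p) (H' : simple_graph q).
Local Notation G := (join_graph H H').
Local Notation incl := (vsubst (K := K) left_vertex).
Local Notation incr := (vsubst (K := K) right_vertex).
Local Notation prl := (vsubst (K := K) left_part).
Local Notation prr := (vsubst (K := K) right_part).

Lemma join_ll i j : G (lshift q i) (lshift q j) = H i j.
Proof. by rewrite /= /join_rel !(unsplitK (inl _)). Qed.

Lemma join_rr i j : G (rshift p i) (rshift p j) = H' i j.
Proof. by rewrite /= /join_rel !(unsplitK (inr _)). Qed.

Lemma join_lr i j : G (lshift q i) (rshift p j).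
Proof. by rewrite /= /join_rel (unsplitK (inl _)) (unsplitK (inr _)). Qed.

Lemma join_rl i j : G (rshift p i) (lshift q j).
Proof. by rewrite adj_sym join_lr. Qed.

Lemma incl_ideal f :
  binomial_edge_ideal K H f -> binomial_edge_ideal K G (incl f).
Proof.
by apply: vsubst_ideal => i j _ _ Hij [<-] [<-]; right; rewrite join_ll.
Qed.

Lemma incr_ideal f :
  binomial_edge_ideal K H' f -> binomial_edge_ideal K G (incr f).
Proof.
by apply: vsubst_ideal => i j _ _ Hij [<-] [<-]; right; rewrite join_rr.
Qed.

Lemma prl_ideal f :
  binomial_edge_ideal K G f -> binomial_edge_ideal K H (prl f).
Proof.
apply: vsubst_ideal => i j a b.
case: (split_ordP i) => u ->; case: (split_ordP j) => v ->;
  rewrite ?part_shiftE //.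
by rewrite join_ll => Huv [<-] [<-]; right.
Qed.

Lemma prr_ideal f :
  binomial_edge_ideal K G f -> binomial_edge_ideal K H' (prr f).
Proof.
apply: vsubst_ideal => i j a b.
case: (split_ordP i) => u ->; case: (split_ordP j) => v ->;
  rewrite ?part_shiftE //.
by rewrite join_rr => Huv [<-] [<-]; right.
Qed.

Lemma prl_incl f : prl (incl f) = f.
Proof.
rewrite vsubst_comp -[RHS]vsubst_id; apply: eq_vsubst => i /=.
exact: left_part_lshift.
Qed.

Lemma prr_incr f : prr (incr f) = f.
Proof.
rewrite vsubst_comp -[RHS]vsubst_id; apply: eq_vsubst => i /=.
exact: right_part_rshift.
Qed.

(** Membership in an edge ideal matters: a constant would survive the composite, whereas every
    generator has its variables set to 0. *)
Lemma prl_incr (G' : simple_graph q) f :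
  binomial_edge_ideal K G' f -> prl (incr f) = 0.
Proof.
rewrite vsubst_comp; apply: vsubst_kill_edges => i j _ /=; left.
exact: left_part_rshift.
Qed.

Lemma prr_incl (G' : simple_graph p) f :
  binomial_edge_ideal K G' f -> prr (incl f) = 0.
Proof.
rewrite vsubst_comp; apply: vsubst_kill_edges => i j _ /=; left.
exact: right_part_lshift.
Qed.

Lemma join_decomposition f :
  binomial_edge_ideal K (complete_graph (p + q)) f ->
  binomial_edge_ideal K G (f - incl (prl f) - incr (prr f)).
Proof.
move: f; apply: edge_ideal_ind => [|f g Jf Jg|h i j _].
- by rewrite !rmorph0 !subr0; apply: binomial_edge_ideal0.
- rewrite !rmorphD /= (_ : _ - _ = (f - incl (prl f) - incr (prr f))
     + (g - incl (prl g) - incr (prr g))); last by ring.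
  exact: binomial_edge_idealD.
rewrite !rmorphM /= !vsubst_edge.
case: (split_ordP i) => u ->; case: (split_ordP j) => v ->;
  rewrite !part_shiftE ?rmorph0 ?mulr0 ?subr0 ?vsubst_edge.
(* For an edge on the left side the right restriction is 0, and restricting then including fixes the
   left vertices and kills the right ones, each of which is adjacent in the join to both ends of the
   edge. *)
- rewrite -mulrBl vsubst_comp; apply: edge_ideal_retract => w.
  case: (split_ordP w) => z ->; rewrite part_shiftE /=; [by left | right].
  by split=> //; apply: join_rl.
- exact/binomial_edge_idealM/edge_ideal_binomial/join_lr.
- exact/binomial_edge_idealM/edge_ideal_binomial/join_rl.
- rewrite -mulrBl vsubst_comp; apply: edge_ideal_retract => w.
  case: (split_ordP w) => z ->; rewrite part_shiftE /=; [right | by left].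
  by split=> //; apply: join_lr.
Qed.

Lemma homog_subspace m k : is_subspace (fun f : {mpoly K[m]} => f \is k.-homog).
Proof. by split=> [|a u v uk vk]; rewrite ?rpred0 // rpredD // rpredZ. Qed.

Lemma quot_dim_join k d e :
  quot_dim (fun f => f \is k.-homog
                     /\ binomial_edge_ideal K (complete_graph p) f)
    (binomial_edge_ideal K H) d ->
  quot_dim (fun f => f \is k.-homog
                     /\ binomial_edge_ideal K (complete_graph q) f)
    (binomial_edge_ideal K H') e ->
  quot_dim (fun f => f \is k.-homog
                     /\ binomial_edge_ideal K (complete_graph (p + q)) f)
    (binomial_edge_ideal K G) (d + e).
Proof.
have sJ n (G' : simple_graph n) : is_subspace (binomial_edge_ideal K G').
  exact/is_ideal_subspace/binomial_edge_ideal_is_ideal.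
have A0 n : (0 : {mpoly K[n + n]}) \is k.-homog
    /\ binomial_edge_ideal K (complete_graph n) (0 : {mpoly K[n + n]}).
  by split; [exact: rpred0 | exact: binomial_edge_ideal0].
move=> Dd De.
have [b [Ab bI bS]] := quot_dimE (A0 p) (sJ _ H) Dd.
have [b' [Ab' b'I b'S]] := quot_dimE (A0 q) (sJ _ H') De.
rewrite -[d]card_ord -[e]card_ord -card_sum.
pose w (t : 'I_d + 'I_e) :=
  match t with inl i => incl (b i) | inr j => incr (b' j) end.
have wE (c : 'I_d + 'I_e -> K) : \sum_t c t *: w t
   = incl (\sum_i c (inl i) *: b i) + incr (\sum_j c (inr j) *: b' j).
  by rewrite big_sumType !vsubst_sum.
have complete_sub l m (s : 'I_l -> option 'I_m) f :
    binomial_edge_ideal K (complete_graph l) f ->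
    binomial_edge_ideal K (complete_graph m) (vsubst s f).
  apply: vsubst_ideal => i j x y _ _ _ /=; rewrite /complete_rel.
  by case: eqVneq; [left | right].
apply: (@quot_dimI _ _ _ _ _ w) => // [[i|j]|c|f [fk Jf]].
- by have [bk Jb] := Ab i; split; [apply: vsubst_homog | apply: complete_sub].
- by have [bk Jb] := Ab' j; split; [apply: vsubst_homog | apply: complete_sub].
(* Restricting the relation to one side kills the summand from the other side and leaves a relation
   in the ideal of that side's graph. *)
- rewrite wE => Jc [i|j].
    apply: (bI (fun i => c (inl i))); have := prl_ideal Jc.
    rewrite rmorphD /= prl_incl (@prl_incr (complete_graph q)) ?addr0 //.
    by apply: subspace_sum => // j _; apply: subspaceZ => //; case: (Ab' j).
  apply: (b'I (fun j => c (inr j))); have := prr_ideal Jc.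
  rewrite rmorphD /= prr_incr (@prr_incl (complete_graph p)) ?add0r //.
  by apply: subspace_sum => // i _; apply: subspaceZ => //; case: (Ab i).
- have [|c Jc] := bS (prl f).
    by split; [apply: vsubst_homog | apply: complete_sub].
  have [|c' Jc'] := b'S (prr f).
    by split; [apply: vsubst_homog | apply: complete_sub].
  (* Expand the two restrictions separately, include both expansions in the join, and add the
     decomposition of [f]. *)
  exists (fun t => match t with inl i => c i | inr j => c' j end); rewrite wE.
  have := join_decomposition Jf.
  have := incl_ideal Jc; have := incr_ideal Jc'; rewrite !rmorphB /=.
  move=> J1 J2 J3; have := binomial_edge_idealD J3 (binomial_edge_idealD J1 J2).
  by congr (binomial_edge_ideal K G _); ring.
Qed.

End Join.

(** * The complete graph *)

Section Complete.
Variable K : fieldType.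

(** Monomials are kept as lists of vertices, so that a common factor can be removed by induction and
    a list can be sorted and cut. *)
Definition xy_word n (u v : seq 'I_n) : {mpoly K[n + n]} :=
  (\prod_(i <- u) xvar K i) * \prod_(i <- v) yvar K i.

Lemma xy_word_consl n (i : 'I_n) u v :
  xy_word (i :: u) v = xvar K i * xy_word u v.
Proof. by rewrite /xy_word big_cons mulrA. Qed.

Lemma xy_word_consr n (i : 'I_n) u v :
  xy_word u (i :: v) = yvar K i * xy_word u v.
Proof. by rewrite /xy_word big_cons mulrCA. Qed.

Lemma xy_word_perm n (u u' v v' : seq 'I_n) :
  perm_eq u u' -> perm_eq v v' -> xy_word u v = xy_word u' v'.
Proof.
by move=> uu' vv'; rewrite /xy_word (perm_big _ uu') (perm_big _ vv').
Qed.

Lemma xy_word_homog n (u v : seq 'I_n) :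
  xy_word u v \is (size u + size v).-homog.
Proof.
elim: u => [|i u IHu] /=; last first.
  rewrite xy_word_consl addSn -add1n; apply: dhomogM => //.
  by rewrite dhomogX /= mdeg1.
rewrite add0n; elim: v => [|i v IHv] /=.
  by rewrite /xy_word !big_nil mulr1 dhomog1.
rewrite xy_word_consr -add1n; apply: dhomogM => //.
by rewrite dhomogX /= mdeg1.
Qed.

(** Straightening by induction on [u]: if its head [i] occurs in [u'], cancel the common factor;
    otherwise [i] occurs in [v'], and an exchange of [x] and [y] moves it into the [x] part
    first. *)
Lemma xy_word_congr n (u u' v v' : seq 'I_n) :
  size u = size u' -> perm_eq (u ++ v) (u' ++ v') ->
  binomial_edge_ideal K (complete_graph n) (xy_word u v - xy_word u' v').
Proof.
elim: u v u' v' => [|i u IHu] v u' v'.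
  move/esym/size0nil => -> /= vv'.
  rewrite (xy_word_perm (perm_refl [::]) vv') subrr.
  exact: binomial_edge_ideal0.
have [iu'|niu'] := boolP (i \in u').
  move=> szu uv; have pu' := perm_to_rem iu'.
  rewrite (xy_word_perm pu' (perm_refl v')) !xy_word_consl -mulrBr.
  apply/binomial_edge_idealM/IHu.
    by have := perm_size pu'; rewrite -szu /= => -[].
  by rewrite -(perm_cons i) (perm_trans uv) // -cat_cons perm_cat2r.
case: u' niu' => //= j u' niu' [szu] uv.
have iv' : i \in v'.
  have := perm_mem uv i; rewrite mem_head -cat_cons mem_cat.
  by rewrite (negbTE niu') => /esym.
have pv' := perm_to_rem iv'; set v'' := rem i v' in pv'.
rewrite (xy_word_perm (perm_refl _) pv') !xy_word_consl xy_word_consr.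
(* The binomial of [i] and [j] trades [x_j y_i] for [x_i y_j], after which [x_i] is a common
   factor. *)
rewrite (_ : _ - _ = xvar K i * (xy_word u v - xy_word u' (j :: v''))
  + xy_word u' v'' * edge_binomial K i j); last first.
  by rewrite xy_word_consr /edge_binomial; ring.
apply: binomial_edge_idealD; apply: binomial_edge_idealM.
  apply: IHu => //; apply/permP => a.
  have /permP/(_ a) := uv; have /permP/(_ a) := pv'.
  by rewrite /= !count_cat /=; lia.
exact: edge_ideal_complete.
Qed.

Lemma prod_mpolyX n (w : seq 'I_n) :
  \prod_(i <- w) 'X_i = 'X_[s2m w] :> {mpoly K[n]}.
Proof.
elim: w => [|i w IHw].
  by rewrite big_nil (_ : s2m [::] = 0%MM) ?mpolyX0.
rewrite big_cons IHw -mpolyXD (_ : s2m (i :: w) = (U_(i) + s2m w)%MM) //.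
by apply/mnmP => j; rewrite mnmDE !mnmE.
Qed.

Lemma mpolyX_xy_word n (m : 'X_{1..n + n}) :
  exists u v : seq 'I_n,
    'X_[m] = xy_word u v /\ (size u + size v)%N = mdeg m.
Proof.
rewrite -{1}[m]s2mK -size_m2s -prod_mpolyX.
elim: (m2s m) => [|z w [u [v [E S]]]].
  by exists [::], [::]; rewrite /xy_word !big_nil mulr1.
rewrite big_cons E /= -S; case: (split_ordP z) => i ->.
  by exists (i :: u), v; rewrite xy_word_consl.
by exists u, (i :: v); rewrite xy_word_consr addnS.
Qed.

(* The map x_i -> s z_i, y_i -> t z_i onto the Segre product of K[s, t] and
   K[z_1, ..., z_n], with t specialised to 1. *)
Definition segre n : {mpoly K[n + n]} -> {poly {mpoly K[n]}} :=
  mmap (polyC \o @mpolyC n K) (fun v => match split v with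
                                        | inl i => ('X_i)%:P * 'X
                                        | inr i => ('X_i)%:P
                                        end).

HB.instance Definition _ n := GRing.RMorphism.copy (@segre n)
  (mmap (polyC \o @mpolyC n K) (fun v => match split v with
                                         | inl i => ('X_i)%:P * 'X
                                         | inr i => ('X_i)%:P
                                         end)).

Lemma segreZ n c (f : {mpoly K[n + n]}) : segre (c *: f) = c%:MP%:P * segre f.
Proof. exact: mmapZ. Qed.

Lemma segre_xvar n (i : 'I_n) : segre (xvar K i) = ('X_i)%:P * 'X.
Proof. by rewrite /segre mmapX mmap1U (unsplitK (inl i)). Qed.

Lemma segre_yvar n (i : 'I_n) : segre (yvar K i) = ('X_i)%:P.
Proof. by rewrite /segre mmapX mmap1U (unsplitK (inr i)). Qed.

Lemma segre_ideal n (f : {mpoly K[n + n]}) :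
  binomial_edge_ideal K (complete_graph n) f -> segre f = 0.
Proof.
move: f; apply: edge_ideal_ind => [|f g f0 g0|h i j _].
- by rewrite rmorph0.
- by rewrite rmorphD /= f0 g0 addr0.
- by rewrite rmorphM rmorphB !rmorphM /= !segre_xvar !segre_yvar; ring.
Qed.

Lemma segre_xy_word n (u v : seq 'I_n) :
  segre (xy_word u v) = ('X_[s2m (u ++ v)])%:P * 'X^(size u).
Proof.
rewrite -prod_mpolyX big_cat /=.
elim: u => [|i u IHu] /=.
  rewrite expr0 mulr1 big_nil mul1r; elim: v => [|i v IHv].
    by rewrite /xy_word !big_nil mulr1 rmorph1.
  by rewrite xy_word_consr big_cons rmorphM /= segre_yvar IHv polyCM.
rewrite xy_word_consl big_cons rmorphM /= segre_xvar IHu !polyCM exprS.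
ring.
Qed.

Lemma quot_dim_complete n k :
  quot_dim (fun f => f \is k.-homog)
    (binomial_edge_ideal K (complete_graph n.+1)) ('C(k + n, k) * k.+1).
Proof.
(* A basis element is a multiset of [k] vertices, stored as a sorted tuple, with a number between 0
   and [k]: that many initial entries become [x] variables and the others [y] variables. *)
pose T := ({t : k.-tuple 'I_n.+1 | t \in basis n.+1 k} * 'I_k.+1)%type.
have -> : ('C(k + n, k) * k.+1)%N = #|{: T}|.
  by rewrite card_prod card_ord card_sig -card_sorted_tuples.
pose b (z : T) := xy_word (take z.2 (val z.1)) (drop z.2 (val z.1)).
have sJ : is_subspace (binomial_edge_ideal K (complete_graph n.+1)).
  exact/is_ideal_subspace/binomial_edge_ideal_is_ideal.
apply: (@quot_dimI _ _ _ _ _ b) => // [[t l]|c Jc [t l]|f fk].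
- have := xy_word_homog (take l (val t)) (drop l (val t)).
  by rewrite -size_cat cat_take_drop size_tuple.
- have := segre_ideal Jc; rewrite rmorph_sum /=.
  (* Distinct basis words have distinct monomials as Segre images, so this coefficient isolates
     [c (t, l)]. *)
  move/(congr1 (fun P : {poly {mpoly K[n.+1]}} => (P`_l)@_(s2m (val t)))).
  rewrite coef0 mcoeff0 coef_sum raddf_sum /= (bigD1 (t, l)) //= big1.
    rewrite addr0 segreZ segre_xy_word /= cat_take_drop size_takel; last first.
      by rewrite size_tuple -ltnS.
    rewrite mulrA -polyCM coefCM coefXn eqxx mulr1.
    by rewrite mcoeffCM mcoeffX eqxx mulr1.
  case=> t' l' ne; rewrite segreZ segre_xy_word /= cat_take_drop.
  rewrite size_takel; last first.
    by rewrite size_tuple -ltnS.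
  rewrite mulrA -polyCM coefCM coefXn.
  have [ll'|] := eqVneq (l : nat) l'; last by rewrite mulr0 mcoeff0.
  rewrite mulr1 mcoeffCM mcoeffX; case: eqP => [tt'|]; last by rewrite mulr0.
  case/eqP: ne; congr (_, _); last exact: val_inj.
  by apply/val_inj; apply: inj_s2m tt'; apply: valP.
(* Sorting all the vertices of a monomial and keeping its number of [x] factors gives the basis word
   to which it is congruent. *)
have span_word m : mdeg m = k ->
    exists z, binomial_edge_ideal K (complete_graph n.+1) ('X_[m] - b z).
  have [u [v [-> <-]]] := mpolyX_xy_word m.
  rewrite -size_cat => sz.
  pose s := sort (fun i j : 'I_n.+1 => (i <= j)%N) (u ++ v).
  have szs : size s == k by rewrite size_sort sz.
  have srt : Tuple szs \in basis n.+1 k.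
    rewrite inE /= sorted_map; apply: sort_sorted => i j; exact: leq_total.
  have lk : (size u < k.+1)%N by rewrite ltnS -sz size_cat leq_addr.
  exists (exist _ (Tuple szs) srt, Ordinal lk); apply: xy_word_congr => /=.
    by rewrite size_takel // (eqP szs) -ltnS.
  by rewrite cat_take_drop perm_sym perm_sort.
rewrite (mpolyE f) big_seq.
elim/big_ind: _ => [|g h [c Jc] [c' Jc']|m mf].
- exists (fun=> 0); rewrite big1 ?subrr; first exact: binomial_edge_ideal0.
  by move=> z _; rewrite scale0r.
- exists (fun z => c z + c' z); have := binomial_edge_idealD Jc Jc'.
  congr (binomial_edge_ideal _ _ _).
  under [in RHS]eq_bigr do rewrite scalerDl.
  by rewrite big_split /= opprD addrACA.
have [z Jz] := span_word _ (dhomogP _ _ _ fk _ mf).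
exists (fun z' => f@_m * (z' == z)%:R).
rewrite (bigD1 z) //= big1 => [|z' /negbTE ->]; last by rewrite mulr0 scale0r.
by rewrite eqxx mulr1 addr0 -scalerBr; apply: subspaceZ.
Qed.

End Complete.

(** * Power series coefficients *)

Section FpsFrac.
Variable R : comUnitRingType.
Implicit Types (P Q : {poly R}) (c d : nat -> R).

(** The equation in degree [k] determines [c k] from the earlier coefficients, because the constant
    term of [Q] can be cancelled. *)
Lemma fps_frac_unique P Q c :
  Q`_0 \is a GRing.unit ->
  (forall k, \sum_(i < k.+1) Q`_(k - i) * c i = P`_k) -> c =1 fps_frac P Q.
Proof.
move=> uQ cE k; elim/ltn_ind: k => k IHk.
have := cE k; rewrite -(@fps_fracE _ P Q k uQ) !big_ord_recr /= subnn.
under eq_bigr => i _ do rewrite IHk //.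
by move/addrI/(mulrI uQ).
Qed.

(** Dividing a power series by [1 - X] replaces its coefficients by their partial sums. *)
Lemma fps_frac_mul_geometric P Q c :
  Q`_0 \is a GRing.unit -> c 0%N = fps_frac P Q 0 ->
  (forall k, c k.+1 = c k + fps_frac P Q k.+1) ->
  c =1 fps_frac P ((1 - 'X) * Q).
Proof.
move=> uQ c0 cS; apply: fps_frac_unique => [|k].
  by rewrite mulrBl mul1r coefB coefXM subr0.
(* A truncation of [c] suffices for the coefficient of degree [k], and turns the identity into one
   between polynomials. *)
pose C := \poly_(i < k.+1) c i.
transitivity ((Q * ((1 - 'X) * C))`_k).
  rewrite mulrCA mulrA coefMr; apply: eq_bigr => i _.
  by rewrite coef_poly ltn_ord.
rewrite coefMr -(@fps_fracE _ P Q k uQ); apply: eq_bigr => i _; congr (_ * _).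
rewrite mulrBl mul1r coefB coefXM !coef_poly ltn_ord.
case: i => -[|i] lt_ik /=; first by rewrite subr0.
by rewrite cS (ltnW lt_ik) addrC addKr.
Qed.

Lemma fps_frac1 P : fps_frac P 1 =1 fun k => P`_k.
Proof.
move=> k; apply/esym; move: k; apply: fps_frac_unique => [|k].
  by rewrite coef1 unitr1.
by rewrite -coefMr mul1r.
Qed.

(** The two terms come from 1 and from [a X], the latter shifted by one degree and hence absent in
    degree 0. Induction on [n] by partial sums, with Pascal's rule as the recurrence. *)
Lemma fps_frac_linear (a : R) n :
  fps_frac (a *: 'X + 1) ((1 - 'X) ^+ n.+1) =1
  fun k => 'C(k + n, n)%:R + (if k is k'.+1 then a * 'C(k' + n, n)%:R else 0).
Proof.
have u0 m : ((1 - 'X : {poly R}) ^+ m)`_0 \is a GRing.unit.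
  by rewrite -horner_coef0 !hornerE subr0 expr1n unitr1.
elim: n => [|n IHn] k; apply/esym; move: k; rewrite exprS;
  apply: fps_frac_mul_geometric => // [|k].
- by rewrite expr0 fps_frac1 coefD coefZ coefX coef1 mulr0 add0r bin0 addr0.
- rewrite expr0 fps_frac1 coefD coefZ coefX coef1 !bin0 /=.
  by case: k => [|k]; rewrite ?bin0 /=; ring.
- by rewrite IHn !binn.
- rewrite IHn; case: k => [|k].
    by rewrite !addSn !add0n (binS n.+1 n) !binn natrD; ring.
  by rewrite !addSn !addnS (binS (k + n).+2) (binS (k + n).+1) !natrD; ring.
Qed.

End FpsFrac.

(** * Comparison of Hilbert series with those of complete graphs *)

Lemma fps_frac_complete n k :
  fps_frac ((n.+1%:R - 1) *: 'X + 1 : {poly int}) ((1 - 'X) ^+ (n.+1 + 1)%N) k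
  = ('C(k + n, k) * k.+1)%:Z.
Proof.
rewrite addn1 -natr1 addrK fps_frac_linear.
rewrite -[in RHS]bin_sub ?leq_addr // addKn.
case: k => [|k]; first by rewrite !add0n !binn addr0.
rewrite addSn binS.
rewrite !natz -!PoszM -!PoszD; congr Posz.
(* After Pascal's rule the left side is [(n+1) C(m, n+1) + C(m, n)] with [m = k+1+n], and
   [(n+1) C(m, n+1) = (k+1) C(m, n)]. *)
have := mul_bin_left (k.+1 + n) n; rewrite addnK addSn -addnS.
by lia.
Qed.

(** Here [r] measures in degree [k] by how much the ideal of [G] falls short of that of the complete
    graph; dimensions add along the quotient map. *)
Lemma hilbert_function_complete_add (K : fieldType) n k r
    (G : simple_graph n) :
  (0 < n)%N ->
  quot_dim (fun f => f \is k.-homog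
                     /\ binomial_edge_ideal K (complete_graph n) f)
    (binomial_edge_ideal K G) r ->
  hilbert_series (binomial_edge_ideal K G) k =
    fps_frac ((n%:R - 1) *: 'X + 1) ((1 - 'X) ^+ (n + 1)%N) k + r%:Z.
Proof.
case: n G => // n G _ hr; have iJ := binomial_edge_ideal_is_ideal K G.
rewrite fps_frac_complete -PoszD; congr Posz.
apply: (has_dim_mod_unique iJ (hilbert_functionP k iJ)).
apply: quot_dim_cat (quot_dim_complete K n k) hr => //.
- exact: homog_subspace.
- exact/is_ideal_subspace/binomial_edge_ideal_is_ideal.
- exact: is_ideal_subspace.
- exact: edge_ideal_sub_complete.
Qed.

Lemma quot_dim_complete_exists (K : fieldType) n k (G : simple_graph n) :
  exists r, quot_dim (fun f => f \is k.-homog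
                               /\ binomial_edge_ideal K (complete_graph n) f)
              (binomial_edge_ideal K G) r.
Proof.
have iJ (G' : simple_graph n) := binomial_edge_ideal_is_ideal K G'.
apply: quot_dim_ker (hilbert_functionP k (iJ G))
  (hilbert_functionP k (iJ (complete_graph n))).
- exact: homog_subspace.
- exact: is_ideal_subspace.
- exact: is_ideal_subspace.
- exact: edge_ideal_sub_complete.
Qed.

Theorem theorem4p2 (K : fieldType) (p q : nat)
    (H : simple_graph p) (H' : simple_graph q)
    (H_disc : disconnected H) (H'_disc : disconnected H') :
  hilbert_series (binomial_edge_ideal K (join_graph H H')) =1
    hilbert_series (binomial_edge_ideal K H)
    \+ hilbert_series (binomial_edge_ideal K H')
    \+ fps_frac ((p%:R + q%:R - 1) *: 'X + 1 : {poly int})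
                ((1 - 'X) ^+ (p + q + 1)%N)
    \- fps_frac ((p%:R - 1) *: 'X + 1 : {poly int}) ((1 - 'X) ^+ (p + 1)%N)
    \- fps_frac ((q%:R - 1) *: 'X + 1 : {poly int}) ((1 - 'X) ^+ (q + 1)%N).
Proof.
(* A disconnected graph has a vertex, so the count for complete graphs, stated for [n.+1] vertices,
   applies. *)
have pos n (G : simple_graph n) : disconnected G -> (0 < n)%N.
  by case/existsP => u _; apply: leq_trans (ltn_ord u).
have p_gt0 := pos _ _ H_disc; have q_gt0 := pos _ _ H'_disc.
move=> k; have [d Hd] := quot_dim_complete_exists K k H.
have [e H'e] := quot_dim_complete_exists K k H'.
have pq_gt0 : (0 < p + q)%N by rewrite addn_gt0 p_gt0.
(* The three graphs differ from their complete graphs by [d], [e] and [d + e] in degree [k];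
   eliminating [d] and [e] leaves the three rational functions of the formula. *)
rewrite /= (hilbert_function_complete_add p_gt0 Hd).
rewrite (hilbert_function_complete_add q_gt0 H'e).
rewrite (hilbert_function_complete_add pq_gt0 (quot_dim_join Hd H'e)).
by rewrite natrD PoszD; ring.
Qed.
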